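(* Let $(k,q)=(1,4)$ or $(2,3)$. There exist a real separable Hilbert space $U$ and a bounded linear operator $R:U\to U$ with the following properties. The image $R^nU$ is one-dimensional for all $n>k$. There is a decomposition $U=U_1+\cdots+U_q$ into mutually orthogonal closed linear subspaces such that, for each $i\in\{1,\ldots,q\}$, the image $R\,U_i$ is contained in the closed linear span of $\bigcup_{j\neq i}U_j$. *)

(* Defs.v *)
From HB Require Import structures.
From mathcomp Require Import all_boot all_order all_algebra.
From mathcomp Require Import sesquilinear.
From mathcomp Require Import all_classical all_reals all_analysis.

Set Implicit Arguments.
Unset Strict Implicit.
Unset Printing Implicit Defensive.

Import Order.TTheory GRing.Theory Num.Theory.
Import numFieldNormedType.Exports.

Local Open Scope classical_set_scope.
Local Open Scope ring_scope.

(* Together with the completeness of [U], this makes [(U, dot)] a real Hilbert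
   space: [{dot U for idfun}] is the type of symmetric positive definite
   bilinear forms on [U]. *)
Definition hilbert_norm (R : realType) (U : completeNormedModType R)
    (dot : {dot U for idfun}) : Prop :=
  forall x : U, `|x| ^+ 2 = dot x x.

Definition separable_space (T : topologicalType) : Prop :=
  exists2 D : set T, countable D & dense D.

Definition bounded_operator (R : realType) (V W : normedModType R)
    (T : {linear V -> W}) : Prop :=
  exists M : R, forall x : V, `|T x| <= M * `|x|.

Definition linear_subspace (R : realType) (U : lmodType R) (A : set U) : Prop :=
  submod_closed (mem A).

Definition linear_span (R : realType) (U : lmodType R) (A : set U) : set U :=
  smallest (@linear_subspace R U) A.

Definition closed_linear_span (R : realType) (U : normedModType R)
    (A : set U) : set U :=
  closure (linear_span A).

Definition one_dimensional (R : realType) (U : lmodType R) (A : set U) : Prop :=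
  exists2 v : U, v != 0 & A = [set c *: v | c in [set: R]].

Definition orthogonal_decomposition (R : realType) (U : normedModType R)
    (dot : {dot U for idfun}) (q : nat) (V : 'I_q -> set U) : Prop :=
  [/\ forall i, linear_subspace (V i) /\ closed (V i),
      forall i j, i != j -> forall x y, V i x -> V j y -> dot x y = 0
    & forall x : U, exists2 y : 'I_q -> U,
        (forall i, V i (y i)) & x = \sum_(i < q) y i].

(* Main.v *)
Require Import Defs.
From HB Require Import structures.
From mathcomp Require Import all_boot all_order all_algebra.
From mathcomp Require Import sesquilinear.
From mathcomp Require Import all_classical all_reals all_analysis.
From mathcomp Require Import ring lra.
Set Implicit Arguments.
Unset Strict Implicit.
Unset Printing Implicit Defensive.
Import Order.TTheory GRing.Theory Num.Theory.
Import numFieldNormedType.Exports.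
Local Open Scope classical_set_scope.
Local Open Scope ring_scope.

(** In finite dimension no such operator exists: its diagonal blocks vanish,
so its trace is 0, whereas an operator all of whose high powers have rank one
has exactly one nonzero eigenvalue, which is simple, hence a nonzero trace.
On sequences this obstruction disappears.  The forward shift S, with
(S x)_k = x_(k-1), and its adjoint S* satisfy S* S = 1 but S S* = 1 - e, where
e is the projection onto the 0-th term: a commutator can have trace one.  So
one looks for a matrix with zero diagonal over the Laurent polynomials in z
that is nilpotent, and substitutes S for z; the powers that vanish for the
symbol become finite-rank operators.

For three summands take
<<
          [   0       1 - S     2    ]
     D =  [ S* - 1      0     S* + 1 ]
          [   2      - 1 - S    0    ] .
>>
The characteristic polynomial of its symbol is the cube of the variable: the
products of opposite entries, 1/z - 2 + z and 4 and - (1/z + 2 + z), add up to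
0, and the two products along 3-cycles cancel.  Computing with S and S* leaves
D^3 = 4 f f^T, where f has the 0-th basis vector in its first and third
components and 0 in its second, and D f = 2 f.  Hence D^n has the line through
f as its image for all n > 2.

For four summands, D^2 - 2 f f^T factors as c b, with the column
c = (1 + S, 2, S - 1) and the row b = (S* + 1, -2, S* - 1), and b c, b D, D c
are all 0.  The square of the block operator
<<
     [  D   c ]
     [ - b  0 ]
>>
is therefore 2 f f^T in the upper left corner and 0 elsewhere, so that all its
powers from the second on have rank one; its diagonal is again 0.

Both operators are leading blocks of one 4 x 4 table ([root_op]); the powers are
computed entry by entry in [iter2_root_op] and [iter3_root_op], and
[one_dimensional_range_iter] passes to all larger powers.  They act on the
space [l2] of square-summable sequences of row vectors of size q, which is
built with its inner product, its completeness ([l2_complete]) and its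
separability ([l2_separable]).  The summands of the decomposition consist of
the sequences supported on one coordinate, and the condition on their images
holds because the table has zero diagonal ([zero_diag_toeplitz_op]). *)

(** * Square-summable sequences of row vectors *)

Section PartialDot.
Variables (R : realType) (q : nat).
Implicit Types x y z : nat -> 'rV[R]_q.

Definition pdot n x y : R := \sum_(k < n) \sum_(j < q) x k 0 j * y k 0 j.

Lemma pdotC n x y : pdot n x y = pdot n y x.
Proof. by apply: eq_bigr => k _; apply: eq_bigr => j _; rewrite mulrC. Qed.

Lemma pdot_linearl n a x y z :
  pdot n (a *: x + y) z = a * pdot n x z + pdot n y z.
Proof.
rewrite /pdot big_distrr -big_split/=; apply: eq_bigr => k _.
rewrite big_distrr -big_split/=; apply: eq_bigr => j _.
by rewrite !mxE mulrDl mulrA.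
Qed.

Lemma pdot_linearr n a x y z :
  pdot n z (a *: x + y) = a * pdot n z x + pdot n z y.
Proof. by rewrite pdotC pdot_linearl !(pdotC n z). Qed.

Lemma pdot_ge0 n x : 0 <= pdot n x x.
Proof.
by apply: sumr_ge0 => k _; apply: sumr_ge0 => j _; rewrite -expr2 sqr_ge0.
Qed.

Lemma pdot_nondecreasing x : nondecreasing_seq (fun n => pdot n x x).
Proof.
apply/nondecreasing_seqP => n; rewrite /pdot big_ord_recr /= lerDl.
by apply: sumr_ge0 => j _; rewrite -expr2 sqr_ge0.
Qed.

Lemma le_sqr_pdot n x (k : 'I_n) (j : 'I_q) : x k 0 j ^+ 2 <= pdot n x x.
Proof.
rewrite /pdot (bigD1 k)//= (bigD1 j)//= -expr2 -addrA lerDl addr_ge0//.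
  by apply: sumr_ge0 => i _; rewrite -expr2 sqr_ge0.
by apply: sumr_ge0 => i _; apply: sumr_ge0 => l _; rewrite -expr2 sqr_ge0.
Qed.

Lemma pdotD n x y : pdot n (x + y) (x + y) =
  pdot n x x + 2 * pdot n x y + pdot n y y.
Proof.
have xy : x + y = 1 *: x + y by rewrite scale1r.
rewrite {1}xy pdot_linearl xy !pdot_linearr (pdotC n y x); ring.
Qed.

Lemma pdotB n x y : pdot n (x - y) (x - y) =
  pdot n x x - 2 * pdot n x y + pdot n y y.
Proof.
have xy : x - y = -1 *: y + x by rewrite scaleN1r addrC.
rewrite {1}xy pdot_linearl xy !pdot_linearr (pdotC n y x); ring.
Qed.

Lemma pdotD_le n x y :
  pdot n (x + y) (x + y) <= 2 * pdot n x x + 2 * pdot n y y.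
Proof. have := pdot_ge0 n (x - y); rewrite pdotB pdotD; lra. Qed.

Lemma pdotZ n a x : pdot n (a *: x) (a *: x) = a ^+ 2 * pdot n x x.
Proof.
have pdot0 z : pdot n 0 z = 0.
  rewrite /pdot big1// => k _; rewrite big1// => j _.
  by rewrite mxE mul0r.
rewrite -[a *: x]addr0 pdot_linearl pdot_linearr pdotC !pdot0; ring.
Qed.

Definition square_summable : {pred nat -> 'rV[R]_q} :=
  [pred x | `[< exists M, forall n, pdot n x x <= M >]].

Lemma square_summableP x :
  reflect (exists M, forall n, pdot n x x <= M) (x \in square_summable).
Proof. exact: asboolP. Qed.

Lemma square_summable_submod : submod_closed square_summable.
Proof.
split=> [|a x y /square_summableP[M xM] /square_summableP[N yN]].
  apply/square_summableP; exists 0 => n.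
  by rewrite -(scale0r 0) pdotZ expr0n mul0r.
apply/square_summableP; exists (2 * (a ^+ 2 * M) + 2 * N) => n.
rewrite (le_trans (pdotD_le _ _ _))// pdotZ lerD// ler_pM2l//.
by rewrite ler_wpM2l// sqr_ge0.
Qed.

HB.instance Definition _ := GRing.isSubmodClosed.Build R (nat -> 'rV[R]_q)
  square_summable square_summable_submod.

(** By polarization it is enough to treat y = x, where the partial sums are
nondecreasing and bounded. *)
Lemma is_cvg_pdot x y : x \in square_summable -> y \in square_summable ->
  cvgn (fun n => pdot n x y).
Proof.
move=> sx sy.
have cvg_sq z : z \in square_summable -> cvgn (fun n => pdot n z z).
  move=> /square_summableP[M zM].
  apply: nondecreasing_is_cvgn (@pdot_nondecreasing z) _.
  by exists M => _ [n _ <-].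
have -> : (fun n => pdot n x y) =
    4^-1 *: ((fun n => pdot n (x + y) (x + y)) -
             (fun n => pdot n (x - y) (x - y))).
  apply/funext => n.
  change (pdot n x y =
    4^-1 * (pdot n (x + y) (x + y) - pdot n (x - y) (x - y))).
  by rewrite pdotD pdotB; field.
apply: is_cvgZl_tmp; apply: is_cvgB; apply: cvg_sq; first exact: rpredD.
exact: rpredB.
Qed.

End PartialDot.

Record l2 (R : realType) (q : nat) := L2 {
  l2_seq :> nat -> 'rV[R]_q;
  l2P : l2_seq \in @square_summable R q
}.
Arguments L2 {R q l2_seq}.

HB.instance Definition _ R q := [isSub for @l2_seq R q].
HB.instance Definition _ R q := [Choice of l2 R q by <:].
HB.instance Definition _ R q := [SubChoice_isSubLmodule of l2 R q by <:].

Section L2Dot.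
Variables (R : realType) (q : nat).
Local Notation U := (l2 R q).
Implicit Types x y z : U.

Lemma l2_eqP x y : (forall k j, x k 0 j = y k 0 j) -> x = y.
Proof.
by move=> xy; apply/val_inj/funext => k /=; apply/rowP => j; exact: xy.
Qed.

Definition l2_dot x y : R := limn (fun n => pdot n x y).

Lemma cvg_pdot x y : (fun n => pdot n x y) @ \oo --> l2_dot x y.
Proof. exact: is_cvg_pdot (l2P x) (l2P y). Qed.

Lemma l2_dotC x y : l2_dot x y = l2_dot y x.
Proof. by rewrite /l2_dot; under eq_fun do rewrite pdotC. Qed.

Lemma l2_dot_linearl z : linear_for *%R (l2_dot ^~ z).
Proof.
move=> a x y; apply/cvg_lim => //.
under eq_fun do rewrite pdot_linearl.
by apply: cvgD; [apply: cvgMl_tmp; exact: cvg_pdot|exact: cvg_pdot].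
Qed.

Lemma pdot_le_dot n x : pdot n x x <= l2_dot x x.
Proof.
exact: nondecreasing_cvgn_le (@pdot_nondecreasing _ _ x) (@cvg_pdot x x) n.
Qed.

Lemma l2_dot_le x M : (forall n, pdot n x x <= M) -> l2_dot x x <= M.
Proof.
by move=> xM; apply: limr_le; [exact: cvg_pdot|exact: nearW].
Qed.

Lemma le_sqr_dot x k j : x k 0 j ^+ 2 <= l2_dot x x.
Proof.
exact: le_trans (le_sqr_pdot x (Ordinal (ltnSn k)) j) (pdot_le_dot k.+1 x).
Qed.

Lemma l2_dot_ge0 x : 0 <= l2_dot x x.
Proof. exact: le_trans (pdot_ge0 0 x) (pdot_le_dot 0 x). Qed.

Lemma l2_dot_eq0 x : l2_dot x x = 0 -> x = 0.
Proof.
move=> x0; apply: l2_eqP => k j; rewrite mxE.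
by apply/eqP; rewrite -sqrf_eq0 eq_le sqr_ge0 -x0 le_sqr_dot.
Qed.

Lemma l2_dot_gt0 x : x != 0 -> 0 < l2_dot x x.
Proof.
move=> x0; rewrite lt_def l2_dot_ge0 andbT.
by apply: contra_neq x0 => /l2_dot_eq0.
Qed.

Lemma l2_dot_linearr z : linear_for (idfun \; *%R) (l2_dot z).
Proof.
by move=> a x y; rewrite l2_dotC l2_dot_linearl !(l2_dotC z).
Qed.

Lemma l2_dot_herm x y : l2_dot x y = (-1) ^+ false * idfun (l2_dot y x).
Proof. by rewrite expr0 mul1r l2_dotC. Qed.

HB.instance Definition _ := bilinear_isBilinear.Build R U U R *%R
  (idfun \; *%R) l2_dot (l2_dot_linearl, l2_dot_linearr).

HB.instance Definition _ :=
  isHermitianSesquilinear.Build R U false idfun l2_dot l2_dot_herm.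

HB.instance Definition _ := isDotProduct.Build R U l2_dot l2_dot_gt0.

End L2Dot.

(** * The Hilbert norm and its completeness *)

Section L2Norm.
Variables (R : realType) (q : nat).
Local Notation U := (l2 R q).
Implicit Types x y z : U.

Lemma l2_dotD x y :
  l2_dot (x + y) (x + y) = l2_dot x x + 2 * l2_dot x y + l2_dot y y.
Proof. by rewrite linearDl !linearDr /= (l2_dotC y x); ring. Qed.

Lemma l2_dotZl a x y : l2_dot (a *: x) y = a * l2_dot x y.
Proof. exact: linearZl_LR. Qed.

Lemma l2_dotZ a x : l2_dot (a *: x) (a *: x) = a ^+ 2 * l2_dot x x.
Proof. by rewrite l2_dotZl l2_dotC l2_dotZl; ring. Qed.

Lemma l2_cauchy_schwarz x y : l2_dot x y ^+ 2 <= l2_dot x x * l2_dot y y.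
Proof.
have dot0 z : l2_dot z 0 = 0 by exact: linear0r.
have [->|y0] := eqVneq y 0; first by rewrite !dot0 expr0n mulr0.
(* The norm of <y, y> x - <x, y> y is nonnegative. *)
rewrite -subr_ge0 -(pmulr_rge0 _ (l2_dot_gt0 y0)).
have := l2_dot_ge0 (l2_dot y y *: x + - l2_dot x y *: y).
rewrite l2_dotD !l2_dotZ l2_dotZl l2_dotC l2_dotZl (l2_dotC y); lra.
Qed.

Definition l2_norm x := Num.sqrt (l2_dot x x).

Lemma sqr_l2_norm x : l2_norm x ^+ 2 = l2_dot x x.
Proof. by rewrite sqr_sqrtr// l2_dot_ge0. Qed.

Lemma ler_l2_normD x y : l2_norm (x + y) <= l2_norm x + l2_norm y.
Proof.
have nge0 z : 0 <= l2_norm z by exact: sqrtr_ge0.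
rewrite -ler_sqr ?nnegrE ?addr_ge0// sqrrD !sqr_l2_norm l2_dotD.
rewrite lerD2r lerD2l -[leRHS]mulr_natl ler_pM2l//.
rewrite (le_trans (ler_norm _))// -ler_sqr ?nnegrE ?mulr_ge0//.
by rewrite exprMn !sqr_l2_norm real_normK ?num_real// l2_cauchy_schwarz.
Qed.

Lemma l2_normZ a x : l2_norm (a *: x) = `|a| * l2_norm x.
Proof. by rewrite /l2_norm l2_dotZ sqrtrM ?sqr_ge0// sqrtr_sqr. Qed.

Lemma l2_norm_eq0 x : l2_norm x = 0 -> x = 0.
Proof.
by move=> x0; apply: l2_dot_eq0; rewrite -sqr_l2_norm x0 expr0n.
Qed.

HB.instance Definition _ :=
  Lmodule_isNormed.Build R U ler_l2_normD l2_normZ l2_norm_eq0.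

Lemma l2_hilbert_norm x : `|x| ^+ 2 = l2_dot x x.
Proof. exact: sqr_l2_norm. Qed.

Lemma l2_norm_le x M : 0 <= M -> (forall n, pdot n x x <= M ^+ 2) -> `|x| <= M.
Proof.
move=> M0 xM; rewrite -ler_sqr ?nnegrE// l2_hilbert_norm.
exact: l2_dot_le.
Qed.

Lemma le_coord_norm x k j : `|x k 0 j| <= `|x|.
Proof.
by rewrite -ler_sqr ?nnegrE// real_normK ?num_real// l2_hilbert_norm le_sqr_dot.
Qed.

Lemma pdot_le_sqr_norm n x : pdot n x x <= `|x| ^+ 2.
Proof. by rewrite l2_hilbert_norm pdot_le_dot. Qed.

(** The entries of a Cauchy filter converge, because each entry is bounded by
the norm; let c be the sequence of their limits.  Passing to the limit in a
partial sum, where only finitely many entries occur, bounds the partial sums of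
x - c uniformly for x far enough in the filter.  This shows both that c is
square-summable and that the filter converges to c in norm. *)
Lemma l2_complete (F : set_system U) : ProperFilter F -> cauchy F -> cvg F.
Proof.
move=> FF /cauchy_ballP F_cauchy.
have coord_cvg k j : cvg ((fun x : U => x k 0 j) @ F).
  apply/cauchy_cvgP/cauchy_ballP => e e0; rewrite near_simpl.
  apply: filterS (F_cauchy e e0) => -[x y] /=.
  rewrite -!ball_normE /=; apply: le_lt_trans.
  by have := le_coord_norm (x - y) k j; rewrite !mxE.
pose c k : 'rV[R]_q := \row_j lim ((fun x : U => x k 0 j) @ F).
have pdot_cvg n x : pdot n (x - y) (x - y) @[y --> F] -->
    pdot n (l2_seq x - c) (l2_seq x - c).
  apply: cvg_big => [|k _]; first exact: add_continuous.
  apply: cvg_big => [|j _]; first exact: add_continuous.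
  have xyc : (x - y) k 0 j @[y --> F] --> (l2_seq x - c) k 0 j.
    under eq_cvg do rewrite !mxE.
    by rewrite !mxE; apply: cvgB; [exact: cvg_cst|exact: coord_cvg].
  exact: cvgM.
have near_c e : 0 < e -> \forall x \near F,
    forall n, pdot n (l2_seq x - c) (l2_seq x - c) <= e ^+ 2.
  move=> e0; apply: filterS (nearP_dep (F_cauchy e e0)) => x xe n.
  apply: cvgr_to_le (pdot_cvg n x) _.
  apply: filterS xe => y; rewrite -ball_normE /= => /ltW xye.
  apply: le_trans (pdot_le_sqr_norm n (x - y)) _.
  by rewrite ler_sqr ?nnegrE// ltW.
have cP : c \in @square_summable R q.
  have [x xc] := filter_ex (near_c 1 ltr01).
  rewrite -[c](subKr (l2_seq x)); apply: rpredB; first exact: l2P.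
  by apply/square_summableP; exists (1 ^+ 2).
apply/cvg_ex; exists (L2 cP); apply/cvgrPdistC_le => e e0.
apply: filterS (near_c e e0) => x xc.
by apply: l2_norm_le => //; exact: ltW.
Qed.

HB.instance Definition _ := Uniform_isComplete.Build U l2_complete.

End L2Norm.

(** * Separability *)

Section Separable.
Variables (R : realType) (q : nat).
Local Notation U := (l2 R q).

Lemma pdot_split (N n : nat) (x : nat -> 'rV[R]_q) : (N <= n)%N ->
  pdot n x x = pdot N x x +
    \sum_(N <= k < n) \sum_(j < q) x k 0 j * x k 0 j.
Proof.
move=> Nn; rewrite /pdot.
rewrite -!(big_mkord xpredT (fun k => \sum_(j < q) x k 0 j * x k 0 j)).
by rewrite (@big_cat_nat _ _ _ N).
Qed.

(** Finite sequences of rational row vectors, continued by 0: a countable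
family. *)
Definition rat_seq (s : seq 'rV[rat]_q) (k : nat) : 'rV[R]_q :=
  map_mx ratr (nth 0 s k).

Lemma rat_seq_summable s : rat_seq s \in @square_summable R q.
Proof.
apply/square_summableP; exists (pdot (size s) (rat_seq s) (rat_seq s)) => n.
have [ns|/ltnW sn] := leqP n (size s); first exact: pdot_nondecreasing.
rewrite (pdot_split _ sn) big_nat big1 ?addr0// => k /andP[sk _].
by rewrite big1// => j _; rewrite mxE nth_default// mxE rmorph0 mul0r.
Qed.

Definition rat_l2 s : U := L2 (rat_seq_summable s).

(** Given e, cut x at a length N beyond which the squares add up to at most
d = e^2 / 8, and approximate the N * q remaining entries by rationals with total
squared error at most d; then the distance is at most e / 2. *)
Lemma l2_separable : separable_space U.
Proof.
exists (range rat_l2).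
  exact: (sub_countable (card_image_le _ _) (countableP _)).
move=> O [x Ox] openO.
have [e /= e0 xeO] : exists2 e : R, 0 < e & ball x e `<=` O.
  by have /nbhs_ballP[e e0 ?] := open_nbhs_nbhs (conj openO Ox); exists e.
pose d := (e / 2) ^+ 2 / 2.
have d0 : 0 < d by rewrite divr_gt0// exprn_gt0// divr_gt0.
have [N tailN] : exists N, l2_dot x x - pdot N x x <= d.
  have /cvgrPdist_le/(_ d d0)[N _ /(_ N (leqnn N))] := @cvg_pdot R q x x.
  by move=> /(le_trans (ler_norm _)); exists N.
pose h := Num.sqrt (d / (N * q).+1%:R).
have h0 : 0 < h by rewrite sqrtr_gt0 divr_gt0.
have /choice[r xr] (kj : nat * 'I_q) :
    exists r : rat, (x kj.1 0 kj.2 - ratr r) ^+ 2 <= d / (N * q).+1%:R.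
  have lohi : x kj.1 0 kj.2 - h < x kj.1 0 kj.2 + h by lra.
  have [r] := rat_in_itvoo lohi.
  rewrite in_itv /= => /andP[lo hi]; exists r.
  rewrite -[leRHS]sqr_sqrtr; last by rewrite divr_ge0// ltW.
  rewrite -real_normK ?num_real// ler_sqr ?nnegrE ?sqrtr_ge0// -/h.
  by rewrite ler_norml; lra.
pose s := mkseq (fun k => \row_j r (k, j)) N.
exists (rat_l2 s); split; last by exists s.
apply: xeO; rewrite -ball_normE /=.
apply: (@le_lt_trans _ _ (e / 2)); last by lra.
have headN : pdot N (x - rat_l2 s) (x - rat_l2 s) <= d.
  apply: (@le_trans _ _ (\sum_(k < N) \sum_(j < q) d / (N * q).+1%:R)).
    apply: ler_sum => k _; apply: ler_sum => j _; rewrite -expr2 !mxE.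
    by rewrite nth_mkseq// mxE (xr (nat_of_ord k, j)).
  rewrite !sumr_const !card_ord -mulrnA -[leLHS]mulr_natr -mulrA.
  rewrite ler_piMr ?(ltW d0)// mulrC ler_pdivrMr// mul1r ler_nat mulnC.
  exact: leqnSn.
apply: l2_norm_le => [|n]; first by rewrite divr_ge0// ltW.
have half : (e / 2) ^+ 2 = d + d by rewrite /d; field.
have [nN|/ltnW Nn] := leqP n N.
  rewrite (le_trans (pdot_nondecreasing _ nN))// (le_trans headN)// half lerDl.
  exact: ltW.
rewrite (pdot_split _ Nn) half lerD//; apply: le_trans tailN.
rewrite lerBrDl (le_trans _ (pdot_le_dot n x))// (pdot_split _ Nn) lerD2l.
rewrite big_nat [leRHS]big_nat ler_sum// => k /andP[Nk _].
apply: ler_sum => j _.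
by rewrite !mxE nth_default ?size_mkseq// mxE rmorph0 subr0.
Qed.

End Separable.

(** * Block tridiagonal Toeplitz operators *)

Section Toeplitz.
Variables (R : realType) (q : nat).
Implicit Types (x : nat -> 'rV[R]_q) (A B C : 'M[R]_q).

Definition forward_shift x (k : nat) : 'rV[R]_q := if k is m.+1 then x m else 0.

Definition toeplitz A B C x (k : nat) : 'rV[R]_q :=
  x k *m A + forward_shift x k *m B + x k.+1 *m C.

Lemma pdotMmx A : exists2 c : R, 0 <= c & forall n x,
  pdot n (fun k => x k *m A) (fun k => x k *m A) <= c * pdot n x x.
Proof.
exists (\sum_(j < q) (\sum_(i < q) `|A i j|) ^+ 2).
  by apply: sumr_ge0 => j _; exact: sqr_ge0.
move=> n x; rewrite /pdot big_distrr/=; apply: ler_sum => k _.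
rewrite big_distrl/=; apply: ler_sum => j _.
set s := \sum_(i < q) x k 0 i * x k 0 i.
have s0 : 0 <= s by apply: sumr_ge0 => i _; rewrite -expr2 sqr_ge0.
rewrite -expr2 -real_normK ?num_real// -[s]sqr_sqrtr// -exprMn.
rewrite ler_sqr ?nnegrE ?mulr_ge0 ?sqrtr_ge0 ?sumr_ge0// mxE.
rewrite (le_trans (ler_norm_sum _ _ _))// big_distrl/=; apply: ler_sum => i _.
rewrite normrM mulrC ler_wpM2l// -ler_sqr ?nnegrE ?sqrtr_ge0// sqr_sqrtr//.
rewrite real_normK ?num_real// /s (bigD1 i)//= -expr2 lerDl.
by apply: sumr_ge0 => l _; rewrite -expr2 sqr_ge0.
Qed.

Lemma pdot_shift n x : pdot n (forward_shift x) (forward_shift x) <= pdot n x x.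
Proof.
case: n => [|n]; first by rewrite /pdot !big_ord0.
apply: le_trans (pdot_nondecreasing x (leqnSn n)).
rewrite [leLHS]/pdot big_ord_recl big1 ?add0r// => j _.
by rewrite mxE mul0r.
Qed.

Lemma pdot_unshift n x :
  pdot n (fun k => x k.+1) (fun k => x k.+1) <= pdot n.+1 x x.
Proof.
rewrite [leRHS]/pdot big_ord_recl lerDr.
by apply: sumr_ge0 => j _; rewrite -expr2 sqr_ge0.
Qed.

(** The backward shift reads one term further, hence the n.+1 on the right. *)
Lemma pdot_toeplitz A B C : exists2 c : R, 0 <= c &
  forall n x, pdot n (toeplitz A B C x) (toeplitz A B C x) <= c * pdot n.+1 x x.
Proof.
have [a a0 Ax] := pdotMmx A; have [b b0 Bx] := pdotMmx B.
have [c c0 Cx] := pdotMmx C.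
exists (2 * (2 * a + 2 * b) + 2 * c) => [|n x]; first by lra.
pose f k := x k *m A; pose g k := forward_shift x k *m B.
pose h k := x k.+1 *m C.
have Tle : pdot n (toeplitz A B C x) (toeplitz A B C x) <=
    2 * (2 * pdot n f f + 2 * pdot n g g) + 2 * pdot n h h.
  apply: le_trans (pdotD_le n (fun k => f k + g k) h) _.
  by rewrite lerD2r ler_pM2l// pdotD_le.
have xS := pdot_nondecreasing x (leqnSn n).
have fle := le_trans (Ax n x) (ler_wpM2l a0 xS).
have gle := le_trans (Bx n _) (ler_wpM2l b0 (le_trans (pdot_shift n x) xS)).
have hle := le_trans (Cx n _) (ler_wpM2l c0 (pdot_unshift n x)).
by rewrite -/f -/g -/h in fle gle hle; lra.
Qed.

Lemma toeplitz_summable A B C x : x \in @square_summable R q ->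
  toeplitz A B C x \in @square_summable R q.
Proof.
move=> /square_summableP[M xM]; have [c c0 cT] := pdot_toeplitz A B C.
apply/square_summableP; exists (c * M) => n.
exact: le_trans (cT _ _) (ler_wpM2l c0 (xM _)).
Qed.

End Toeplitz.

Section ToeplitzOperator.
Variables (R : realType) (q : nat).
Local Notation U := (l2 R q).

Definition toeplitz_op (A B C : 'M[R]_q) (x : U) : U :=
  L2 (toeplitz_summable A B C (l2P x)).

Lemma toeplitz_op_linear A B C : linear (toeplitz_op A B C).
Proof.
move=> a x y; apply: val_inj; apply/funext => k /=.
have shiftE : forward_shift (a *: x + y) k =
    a *: forward_shift x k + forward_shift y k.
  by case: k => //=; rewrite scaler0 addr0.
rewrite /toeplitz shiftE !mulmxDl -!scalemxAl.
change (a *: (x k *m A) + y k *m A +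
    (a *: (forward_shift x k *m B) + forward_shift y k *m B) +
    (a *: (x k.+1 *m C) + y k.+1 *m C) =
  a *: (x k *m A + forward_shift x k *m B + x k.+1 *m C) +
  (y k *m A + forward_shift y k *m B + y k.+1 *m C)).
rewrite !scalerDr.
by rewrite [RHS]addrACA; congr (_ + _); rewrite addrACA.
Qed.

HB.instance Definition _ A B C :=
  GRing.isLinear.Build R U U _ (toeplitz_op A B C) (toeplitz_op_linear A B C).

Lemma toeplitz_op_bounded A B C :
  bounded_operator (toeplitz_op A B C : {linear U -> U}).
Proof.
have [c c0 cT] := pdot_toeplitz A B C.
exists (Num.sqrt c) => x; apply: l2_norm_le => [|n].
  by rewrite mulr_ge0 ?sqrtr_ge0.
rewrite exprMn sqr_sqrtr//.
exact: le_trans (cT n x) (ler_wpM2l c0 (pdot_le_sqr_norm _ _)).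
Qed.

End ToeplitzOperator.

(** * The decomposition by coordinates *)

Section Decomposition.
Variables (R : realType) (q : nat).
Local Notation U := (l2 R q).

Definition coord_subspace (i : 'I_q) : set U :=
  [set x : U | forall k j, j != i -> x k 0 j = 0].

(** The projection is a Toeplitz operator itself, which makes it well defined on
square-summable sequences. *)
Definition coord_proj (i : 'I_q) : U -> U := toeplitz_op (delta_mx i i) 0 0.

Lemma coord_projE i x k j :
  coord_proj i x k 0 j = if j == i then x k 0 j else 0.
Proof.
rewrite /= /toeplitz !mulmx0 !addr0 mxE (bigD1 i)//= big1 => [|l li].
  by rewrite !mxE eqxx addr0; case: eqP => [->|]; rewrite ?mulr1 ?mulr0.
by rewrite !mxE (negPf li) mulr0.
Qed.

Lemma coord_proj_mem i x : coord_subspace i (coord_proj i x).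
Proof. by move=> k j ji; rewrite coord_projE (negPf ji). Qed.

Lemma sum_coord_proj x : x = \sum_(i < q) coord_proj i x.
Proof.
apply: l2_eqP => k j.
rewrite (big_morph (fun y : U => y k 0 j) (id1 := 0) (op1 := +%R));
  last 2 first.
- by move=> y z; rewrite mxE.
- by rewrite mxE.
rewrite (bigD1 j)//= big1 => [|i ij]; first by rewrite coord_projE eqxx addr0.
by rewrite coord_projE eq_sym (negPf ij).
Qed.

Lemma coord_subspace_linear i : linear_subspace (coord_subspace i).
Proof.
split=> [|a x y]; rewrite !inE.
  by move=> k j _; rewrite mxE.
by move=> xV yV k j ji; rewrite !mxE xV// yV// mulr0 addr0.
Qed.

Lemma coord_subspace_closed i : closed (coord_subspace i).
Proof.
move=> x xV k j ji; apply/eqP; rewrite -normr_le0.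
apply/ler_addgt0Pr => e e0; rewrite add0r.
have [y [yV]] := xV _ (nbhsx_ballx x e e0).
rewrite -ball_normE /= => /ltW; apply: le_trans.
by have := le_coord_norm (x - y) k j; rewrite !mxE yV// subr0.
Qed.

Lemma coord_subspace_orthogonal i j x y : i != j ->
  coord_subspace i x -> coord_subspace j y -> l2_dot x y = 0.
Proof.
move=> ij xV yV; rewrite /l2_dot.
under eq_fun => n.
  rewrite (_ : pdot n x y = 0); first over.
  rewrite /pdot big1// => k _; rewrite big1// => l _.
  have [->|li] := eqVneq l i; first by rewrite yV// mulr0.
  by rewrite xV// mul0r.
exact: lim_cst.
Qed.

Lemma coord_subspace_decomposition :
  orthogonal_decomposition (@l2_dot R q) coord_subspace.
Proof.
split=> [i|i j ij x y|x].
- by split; [exact: coord_subspace_linear|exact: coord_subspace_closed].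
- exact: coord_subspace_orthogonal.
- exists (fun i => coord_proj i x); last exact: sum_coord_proj.
  by move=> i; exact: coord_proj_mem.
Qed.

Lemma closed_linear_span_sum (V : normedModType R) (A : set V) (I : finType)
    (P : pred I) (y : I -> V) :
  (forall i, P i -> A (y i)) -> closed_linear_span A (\sum_(i | P i) y i).
Proof.
move=> yA; apply: subset_closure => B [[B0 BD] AB].
apply: big_ind => [|u v Bu Bv|i Pi].
- by rewrite inE in B0.
- by have := BD 1 u v; rewrite !inE scale1r; apply.
- exact/AB/yA.
Qed.

(** The i-th coordinate of the image vanishes, so the image is the sum of its
projections to the other coordinates. *)
Lemma zero_diag_toeplitz_op (A B C : 'M[R]_q) i :
    A i i = 0 -> B i i = 0 -> C i i = 0 ->
  toeplitz_op A B C @` coord_subspace i `<=`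
    closed_linear_span (\bigcup_(j in [set j | j != i]) coord_subspace j).
Proof.
move=> Aii Bii Cii _ [x xV <-]; set y := toeplitz_op A B C x.
have diag0 (M : 'M[R]_q) (v : 'rV[R]_q) :
    M i i = 0 -> (forall j, j != i -> v 0 j = 0) -> (v *m M) 0 i = 0.
  move=> Mii v0; rewrite mxE big1// => l _.
  have [->|li] := eqVneq l i; first by rewrite Mii mulr0.
  by rewrite v0// mul0r.
have yi k : y k 0 i = 0.
  change ((x k *m A + forward_shift x k *m B + x k.+1 *m C) 0 i = 0).
  rewrite mxE [(_ + _ : 'rV__) 0 i]mxE !diag0 ?addr0//.
  - exact: xV.
  - by move=> j ji; case: k => [|k] /=; [rewrite mxE|exact: xV].
  - exact: xV.
have yi0 : coord_proj i y = 0.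
  apply: l2_eqP => k j; rewrite coord_projE [RHS]mxE.
  by case: eqP => [->|].
rewrite [y]sum_coord_proj (bigD1 i)//= yi0 add0r.
by apply: closed_linear_span_sum => j ji; exists j => //; exact: coord_proj_mem.
Qed.

End Decomposition.

(** * A zero-diagonal operator with a rank-one power *)

(** The image of the m-th power lies on the line of the eigenvector f, which T
maps onto itself because the eigenvalue is not 0. *)
Lemma one_dimensional_range_iter (R : realType) (U : lmodType R)
    (T : {linear U -> U}) (f : U) (a : R) (m n : nat) :
  f != 0 -> a != 0 -> T f = a *: f ->
  (forall x, exists c, iter m T x = c *: f) ->
  (m <= n)%N -> one_dimensional (range (iter n T)).
Proof.
move=> f0 a0 Tf rank1 mn.
have iterf i c : iter i T (c *: f) = (c * a ^+ i) *: f.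
  elim: i => [|i IH]; first by rewrite mulr1.
  by rewrite iterS IH linearZ /= Tf scalerA exprSr mulrA.
exists f => //; apply/seteqP; split=> [_ [x _ <-]|_ [c _ <-]] /=.
  have [c xc] := rank1 x.
  by exists (c * a ^+ (n - m)) => //; rewrite -iterf -xc -iterD subnK.
by exists ((c / a ^+ n) *: f) => //; rewrite iterf divfK// expf_neq0.
Qed.

Section Coordinates.
Variables (R : realType) (q : nat).
Implicit Types u v : 'rV[R]_q.

(** Indexing by naturals, with value 0 out of range, lets one formula describe
the operators for q = 3 and q = 4. *)
Definition entry v (i : nat) : R := oapp (v 0) 0 (insub i : option 'I_q).

Lemma entry_ord v (j : 'I_q) : entry v j = v 0 j.
Proof. by rewrite /entry valK. Qed.

Lemma entry_out v i : (q <= i)%N -> entry v i = 0.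
Proof. by move=> qi; rewrite /entry insubN// -leqNgt. Qed.

Lemma entry0 i : entry 0 i = 0.
Proof. by rewrite /entry; case: insub => //= j; rewrite mxE. Qed.

Lemma entryD u v i : entry (u + v) i = entry u i + entry v i.
Proof. by rewrite /entry; case: insub => [j|] /=; rewrite ?addr0// mxE. Qed.

Lemma entryZ a v i : entry (a *: v) i = a * entry v i.
Proof. by rewrite /entry; case: insub => [j|] /=; rewrite ?mulr0// mxE. Qed.

(** The inner list number j holds the coefficients of the output coordinate j;
as vectors are rows and matrices act on the right, this is the transpose of the
usual layout. *)
Definition table_mx (s : seq (seq int)) : 'M[R]_q :=
  \matrix_(i, j) ((nth [::] s j)`_i)%:~R.

Lemma entry_mul_table s v (j p : nat) : (j < q)%N -> (q <= p)%N ->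
  entry (v *m table_mx s) j = \sum_(i < p) entry v i * ((nth [::] s j)`_i)%:~R.
Proof.
move=> jq qp; rewrite -[j]/(nat_of_ord (Ordinal jq)) entry_ord mxE /=.
pose F i : R := entry v i * ((nth [::] s j)`_i)%:~R.
rewrite (eq_bigr (fun i : 'I_q => F i)) => [|i _]; last first.
  by rewrite /F mxE entry_ord.
rewrite (big_ord_widen p F qp).
rewrite big_mkcond; apply: eq_bigr => i _; case: ltnP => // qi.
by rewrite /F entry_out// mul0r.
Qed.

End Coordinates.

(** The coefficients, with the factors 1, S and S* respectively, of the table
<<
     [     0        1 - S     2      1 + S ]
     [   S* - 1       0     S* + 1     2   ]
     [     2       - 1 - S    0      S - 1 ]
     [ - S* - 1       2     1 - S*     0   ] .
>>
*)
Definition same_table : seq (seq int) :=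
  [:: [:: 0; 1; 2; 1]; [:: -1; 0; 1; 2]; [:: 2; -1; 0; -1]; [:: -1; 2; 1; 0]].

Definition prev_table : seq (seq int) :=
  [:: [:: 0; -1; 0; 1]; [::]; [:: 0; -1; 0; 1]; [::]].

Definition next_table : seq (seq int) :=
  [:: [::]; [:: 1; 0; 1; 0]; [::]; [:: -1; 0; -1; 0]].

Section Operator.
Variables (R : realType) (q : nat).
Local Notation U := (l2 R q).
Implicit Types x : U.

(** [root_op] on arbitrary sequences, kept apart so that its iterates can be
unfolded one at a time. *)
Definition root_seq : (nat -> 'rV[R]_q) -> nat -> 'rV[R]_q :=
  toeplitz (table_mx R q same_table) (table_mx R q prev_table)
    (table_mx R q next_table).

(** A square root of a rank-one operator for q = 4, a cube root for q = 3. *)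
Definition root_op : U -> U :=
  toeplitz_op (table_mx R q same_table) (table_mx R q prev_table)
    (table_mx R q next_table).

Lemma table_diag0 (i : 'I_q) : (q <= 4)%N ->
  [/\ table_mx R q same_table i i = 0, table_mx R q prev_table i i = 0
    & table_mx R q next_table i i = 0].
Proof.
move=> q4; rewrite !mxE; case: i => i /= iq.
by case: i iq => [|[|[|[|i]]]] iq //; have := leq_trans iq q4.
Qed.

Lemma entry_root_seq (x : nat -> 'rV[R]_q) k j : (q <= 4)%N -> (j < q)%N ->
  let X := entry (x k) in
  let P := entry (forward_shift x k) in
  let N := entry (x k.+1) in
  entry (root_seq x k) j =
  [:: X 1 + 2 * X 2 + X 3 - P 1 + P 3;
      - X 0 + X 2 + 2 * X 3 + N 0 + N 2;
      2 * X 0 - X 1 - X 3 - P 1 + P 3;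
      - X 0 + 2 * X 1 + X 2 - N 0 - N 2]`_j.
Proof.
move=> q4 jq; rewrite /root_seq /toeplitz !entryD.
rewrite !(entry_mul_table _ _ jq q4) /=.
rewrite !big_ord_recl !big_ord0 /=.
have j4 := leq_trans jq q4.
by move: j j4 {jq} => [|[|[|[|j]]]] //= _; ring.
Qed.

(** A finite sequence with rational entries is already known to be
square-summable by [rat_seq_summable]. *)
Definition eigvec : U :=
  rat_l2 R [:: \row_(j < q) ((j == 0 :> nat) || (j == 2 :> nat))%:R].

Lemma entry_eigvec k j : (j < q)%N -> entry (eigvec k) j =
  ((k == 0)%N && ((j == 0)%N || (j == 2)%N))%:R.
Proof.
move=> jq; rewrite -[in LHS](_ : nat_of_ord (Ordinal jq) = j)// entry_ord.
rewrite /eigvec /= /rat_seq; case: k => [|k] /=.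
  by rewrite !mxE rmorph_nat.
by rewrite nth_nil !mxE rmorph0.
Qed.

Lemma l2_entryP (x y : U) :
  (forall k j, (j < q)%N -> entry (x k) j = entry (y k) j) -> x = y.
Proof. by move=> xy; apply: l2_eqP => k j; rewrite -!entry_ord xy. Qed.

End Operator.

Lemma iter2_root_op (R : realType) (x : l2 R 4) :
  iter 2 (@root_op R 4) x =
  (2 * (entry (x 0) 0 + entry (x 0) 2)) *: eigvec R 4.
Proof.
apply: l2_entryP => k j j4.
change (entry (root_seq (root_seq x) k) j =
  entry ((2 * (entry (x 0) 0 + entry (x 0) 2)) *: (eigvec R 4 k)) j).
rewrite entryZ entry_eigvec// entry_root_seq//.
(* Two applications reach back to x (k - 2): k = 0 and k = 1 are at the
   boundary. *)
case: j j4 => [|[|[|[|j]]]] //= _; case: k => [|[|k]] /=;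
  rewrite !entry_root_seq//= ?entry0; ring.
Qed.

Lemma iter3_root_op (R : realType) (x : l2 R 3) :
  iter 3 (@root_op R 3) x =
  (4 * (entry (x 0) 0 + entry (x 0) 2)) *: eigvec R 3.
Proof.
apply: l2_entryP => k j j3.
change (entry (root_seq (root_seq (root_seq x)) k) j =
  entry ((4 * (entry (x 0) 0 + entry (x 0) 2)) *: (eigvec R 3 k)) j).
have entry3 (y : nat -> 'rV[R]_3) n i : (i < 3)%N ->
  let X := entry (y n) in
  let P := entry (forward_shift y n) in
  let N := entry (y n.+1) in
  entry (root_seq y n) i =
    [:: X 1 + 2 * X 2 - P 1; - X 0 + X 2 + N 0 + N 2; 2 * X 0 - X 1 - P 1]`_i.
  move=> i3; rewrite entry_root_seq// !(@entry_out _ _ _ 3)//.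
  by case: i i3 => [|[|[|i]]] //= _; ring.
rewrite entryZ entry_eigvec// entry3//.
(* Three applications reach back to x (k - 3). *)
case: j j3 => [|[|[|j]]] //= _; case: k => [|[|[|k]]] /=;
  do 2!rewrite ?entry3//= ?entry0; ring.
Qed.

Lemma root_op_eigvec (R : realType) (q : nat) : (2 < q <= 4)%N ->
  root_op (eigvec R q) = 2 *: eigvec R q.
Proof.
move=> /andP[q2 q4]; apply: l2_entryP => k j jq.
change (entry (root_seq (eigvec R q) k) j = entry (2 *: (eigvec R q k)) j).
have f_entry i n : (i < 3)%N ->
    entry (eigvec R q n) i = (((i == 0) || (i == 2)) && (n == 0))%N%:R.
  by move=> i3; rewrite entry_eigvec ?(leq_trans i3 q2)// andbC.
have f3 n : entry (eigvec R q n) 3 = 0.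
  have [q3|q3] := leqP q 3; first exact: entry_out.
  by rewrite entry_eigvec// andbF.
have f0 i : entry (forward_shift (eigvec R q) 0) i = 0 by exact: entry0.
have fS n : forward_shift (eigvec R q) n.+1 = eigvec R q n by [].
rewrite entryZ entry_root_seq//; have j4 := leq_trans jq q4.
case: j jq j4 => [|[|[|[|j]]]] // _ _; case: k => [|k];
  rewrite [LHS]/= ?f0 ?fS ?f3 ?f_entry//=; ring.
Qed.

Lemma eigvec_neq0 (R : realType) (q : nat) : (0 < q)%N -> eigvec R q != 0.
Proof.
move=> q0; apply/eqP => /(congr1 (fun x : l2 R q => entry (x 0) 0)).
by rewrite entry_eigvec//= entry0 => /eqP; rewrite oner_eq0.
Qed.

Theorem corollary8 (R : realType) (k q : nat)
    (hkq : (k = 1%N /\ q = 4%N) \/ (k = 2%N /\ q = 3%N)) :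
  exists (U : completeNormedModType R) (dot : {dot U for idfun})
         (T : {linear U -> U}),
    [/\ hilbert_norm dot,
        separable_space U,
        bounded_operator T,
        forall n : nat, (k < n)%N -> one_dimensional (range (iter n T))
      & exists V : 'I_q -> set U,
          orthogonal_decomposition dot V /\
          forall i : 'I_q,
            T @` V i `<=`
              closed_linear_span (\bigcup_(j in [set j | j != i]) V j)].
Proof.
have /andP[q2 q4] : (2 < q <= 4)%N by case: hkq => -[_ ->].
exists (l2 R q), (@l2_dot R q), (@root_op R q); split.
- exact: l2_hilbert_norm.
- exact: l2_separable.
- exact: toeplitz_op_bounded.
- move=> n; have two0 : 2 != 0 :> R by rewrite pnatr_eq0.
  apply: one_dimensional_range_iter (eigvec_neq0 R (ltnW (ltnW q2))) two0 _ _.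
    by apply: root_op_eigvec; rewrite q2.
  move=> x; case: hkq => -[? ?]; subst k q; eexists.
    exact: iter2_root_op.
  exact: iter3_root_op.
- exists (@coord_subspace R q).
  split; first exact: coord_subspace_decomposition.
  by move=> i; have [? ? ?] := table_diag0 R i q4; exact: zero_diag_toeplitz_op.
Qed.
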